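(* Let $g:\mathbb R^N\to\mathbb R$, $g(x)=\max_{i=1,\ldots,\ell}(p_i^Tx+\gamma_i)$, with $(p_i,\gamma_i)\in\mathbb R^N\times\mathbb R$, let $A\in\mathbb R^{m\times N}$, $y\in\mathbb R^m$, $C\in\mathbb R^{p\times N}$, $d\in\mathbb R^p$, let $f:\mathbb R^m\to\mathbb R$ be a $C^1$ strictly convex function, and let $\varepsilon\in\mathbb R$. Consider the problem $$(\mathrm{D1}):\quad \min_{x\in\mathbb R^N} g(x)\quad\text{subject to}\quad f(Ax-y)\le\varepsilon,\ \ Cx\ge d,$$ which is assumed to have an optimal solution. Let $x^*\in\mathbb R^N$ be a feasible point of (D1), and let $\alpha$, $\mathcal I$, $W$ be as defined in the context. C.1. Suppose $f(Ax^*-y)<\varepsilon$. Then $x^*$ is the unique minimizer of (D1) if and only if $\{v\in\mathbb R^N\mid C_{\alpha\bullet}v=0,\ Wv=0\}=\{0\}$ and there exist $z\in\mathbb R^{|\alpha|}_{++}$ and $z'\in\mathbb R^{|\mathcal I|}$ with $0<z'<\mathbf 1$ and $\mathbf 1^Tz'=1$ such that $C_{\alpha\bullet}^Tz=W^Tz'$. C.2. Suppose $f(Ax^*-y)=\varepsilon$. Then $x^*$ is the unique minimizer of (D1) if and only if the following hold: (2.i) $\{v\in\mathbb R^N\mid Av=0,\ C_{\alpha\bullet}v=0,\ Wv=0\}=\{0\}$; (2.ii) there exist $z\in\mathbb R^m$, $z'\in\mathbb R^{|\alpha|}_{++}$, and $z''\in\mathbb R^{|\mathcal I|}$ with $0<z''<\mathbf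 1$ and $\mathbf 1^Tz''=1$ such that $A^Tz-C_{\alpha\bullet}^Tz'+W^Tz''=0$; (2.iii) if $\mathcal K:=\{v\in\mathbb R^N\mid(\nabla f(Ax^*-y))^TAv<0,\ C_{\alpha\bullet}v\ge0\}$ is nonempty, then there exist $w\in\mathbb R^{|\alpha|}_+$ and $w'\in\mathbb R^{|\mathcal I|}_+$ such that $A^T\nabla f(Ax^*-y)-C_{\alpha\bullet}^Tw+W^Tw'=0$.
   Context: Vector inequalities are componentwise; $\mathbf 1$ is the vector of ones; $\mathbb R^n_+$ and $\mathbb R^n_{++}$ are the nonnegative and (strictly) positive orthants. For a matrix $M$ and row index set $\alpha$, $M_{\alpha\bullet}$ is the submatrix of rows indexed by $\alpha$. Given $x^*$ with $Cx^*\ge d$: $\alpha:=\{i\in\{1,\ldots,p\} \mid (Cx^*-d)_i=0\}$, $\mathcal I:=\{j\in\{1,\ldots,\ell\}\mid p_j^Tx^*+\gamma_j=g(x^* )\}$, and $W\in\mathbb R^{|\mathcal I|\times N}$ is the matrix whose rows are $p_i^T$, $i\in\mathcal I$. It is a standing convention that for each $i\in\mathcal I$, $p_i$ is not a convex combination of the other $p_j$, $j\in\mathcal I$.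
   Formalization: When 𝓘 has a single element, the bounds z' < 1 (in C.1) and z'' < 1 (in C.2) are dropped, since they contradict 1ᵀz' = 1 and 1ᵀz'' = 1 and make the stated equivalences false; for |𝓘| ≥ 2 the conditions are as stated. *)

(* Defs.v *)
From mathcomp Require Export all_boot all_order all_algebra.
From mathcomp Require Export all_classical all_reals all_analysis.

Set Implicit Arguments.
Unset Strict Implicit.
Unset Printing Implicit Defensive.

Export Order.TTheory GRing.Theory Num.Theory.
Export numFieldNormedType.Exports.

Local Open Scope classical_set_scope.
Local Open Scope ring_scope.

Definition vle (R : realType) (n : nat) (u v : 'cV[R]_n) : Prop :=
  forall i, u i 0 <= v i 0.

Definition vlt (R : realType) (n : nat) (u v : 'cV[R]_n) : Prop :=
  forall i, u i 0 < v i 0.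

(* The index set has l.+1 elements, so that the maximum is over a nonempty
   family; the j-th row of P is p_j^T. *)
Definition max_affine (R : realType) (N l : nat) (P : 'M[R]_(l.+1, N))
    (gamma : 'cV[R]_l.+1) (x : 'cV[R]_N) : R :=
  \big[Num.max/(P *m x + gamma) ord0 0]_(j < l.+1) (P *m x + gamma) j 0.

Definition strictly_convex (R : realType) (m : nat) (f : 'cV[R]_m -> R) : Prop :=
  forall (u v : 'cV[R]_m) (t : R), u != v -> 0 < t -> t < 1 ->
    f (t *: u + (1 - t) *: v) < t * f u + (1 - t) * f v.

Definition gradient (R : realType) (m : nat) (f : 'cV[R]_m -> R)
    (u : 'cV[R]_m) : 'cV[R]_m :=
  \col_i 'D_(delta_mx i 0) f u.

Definition continuously_differentiable (R : realType) (m : nat)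
    (f : 'cV[R]_m -> R) : Prop :=
  (forall u : 'cV[R]_m, differentiable f u) /\ continuous (gradient f).

Definition feasible (R : realType) (N m p : nat) (f : 'cV[R]_m -> R)
    (A : 'M[R]_(m, N)) (y : 'cV[R]_m) (eps : R)
    (C : 'M[R]_(p, N)) (d : 'cV[R]_p) : set 'cV[R]_N :=
  [set x | f (A *m x - y) <= eps /\ vle d (C *m x)].

Definition minimizer (R : realType) (T : Type) (g : T -> R) (S : set T)
    (x : T) : Prop :=
  S x /\ forall x', S x' -> g x <= g x'.

Definition unique_minimizer (R : realType) (T : Type) (g : T -> R) (S : set T)
    (x : T) : Prop :=
  minimizer g S x /\ forall x', minimizer g S x' -> x' = x.

Definition active_constraints (R : realType) (N p : nat) (C : 'M[R]_(p, N))
    (d : 'cV[R]_p) (x : 'cV[R]_N) : {set 'I_p} :=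
  finset (fun i => (C *m x - d) i 0 == 0).

Definition active_pieces (R : realType) (N l : nat) (P : 'M[R]_(l.+1, N))
    (gamma : 'cV[R]_l.+1) (x : 'cV[R]_N) : {set 'I_l.+1} :=
  finset (fun j => (P *m x + gamma) j 0 == max_affine P gamma x).

Definition rows (R : realType) (N k : nat) (M : 'M[R]_(k, N)) (J : {set 'I_k}) :
    'M[R]_(#|J|, N) :=
  rowsub (fun i : 'I_#|J| => enum_val i) M.

Definition convex_combination (R : realType) (N k : nat) (M : 'M[R]_(k, N))
    (J : {set 'I_k}) (v : 'rV[R]_N) : Prop :=
  exists t : 'I_k -> R,
    [/\ forall j, j \in J -> 0 <= t j,
        \sum_(j in J) t j = 1 &
        v = \sum_(j in J) t j *: row j M].

(* 0 < z < 1 and 1^T z = 1.  For k = 1 the last condition forces z = 1, so no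
   vector satisfies z < 1 and that bound is not imposed; for k >= 2 it is. *)
Definition positive_weights (R : realType) (k : nat) (z : 'cV[R]_k) : Prop :=
  [/\ vlt 0 z,
      (1 < k)%N -> vlt z (const_mx 1) &
      \sum_i z i 0 = 1].

(* Main.v *)
From mathcomp Require Import ring lra.
Require Import Defs.

(** Since [g] is piecewise affine and [C x >= d] is polyhedral, a small step
    from [xs] along [v] keeps the linear constraints and does not increase [g]
    exactly when [C_alpha v >= 0] and [W v <= 0].  When [f] is inactive at [xs],
    uniqueness says that this cone is [{0}].  When it is active, strict
    convexity shows that a direction is also admissible for [f] iff [A v = 0] or
    the derivative of [f] along [A v] is negative; uniqueness thus says that the
    cone meets [ker A] only in [0] (Stiemke) and contains no strict descent
    direction of [f o A] (Farkas). *)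

Set Implicit Arguments.
Unset Strict Implicit.

Local Open Scope classical_set_scope.
Local Open Scope ring_scope.

(** * Componentwise order and products of nonnegative vectors *)

Lemma vle_col_mx (R : realType) (n1 n2 : nat)
    (u1 : 'cV[R]_n1) (u2 : 'cV[R]_n2) :
  vle 0 (col_mx u1 u2) <-> vle 0 u1 /\ vle 0 u2.
Proof.
split=> [h|[h1 h2] i].
  split=> i; rewrite mxE.
    by have := h (lshift _ i); rewrite col_mxEu mxE.
  by have := h (rshift _ i); rewrite col_mxEd mxE.
case: (split_ordP i) => j ->; rewrite mxE.
  by rewrite col_mxEu; have := h1 j; rewrite mxE.
by rewrite col_mxEd; have := h2 j; rewrite mxE.
Qed.

Lemma vle0N (R : realType) (n : nat) (u : 'cV[R]_n) : vle 0 (- u) <-> vle u 0.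
Proof. by split=> h i; have := h i; rewrite !mxE oppr_ge0. Qed.

Lemma vle0_anti (R : realType) (n : nat) (u : 'cV[R]_n) :
  vle 0 u -> vle u 0 -> u = 0.
Proof.
move=> u0 u0'; apply/matrixP => i j; rewrite (ord1 j).
by apply/eqP; rewrite eq_le u0 u0'.
Qed.

Lemma vltW (R : realType) (n : nat) (u v : 'cV[R]_n) : vlt u v -> vle u v.
Proof. by move=> h i; apply/ltW. Qed.

Lemma dot_ge0 (R : realType) (n : nat) (u v : 'cV[R]_n) :
  vle 0 u -> vle 0 v -> 0 <= (u^T *m v) 0 0.
Proof.
move=> u0 v0; rewrite mxE sumr_ge0// => i _; rewrite mxE mulr_ge0//.
  by have := u0 i; rewrite mxE.
by have := v0 i; rewrite mxE.
Qed.

Lemma dot_pos_eq0 (R : realType) (n : nat) (u v : 'cV[R]_n) :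
  vlt 0 u -> vle 0 v -> (u^T *m v) 0 0 = 0 -> v = 0.
Proof.
move=> u0 v0; rewrite mxE => /eqP; rewrite psumr_eq0; last first.
  move=> i _; rewrite mxE mulr_ge0//.
    by have := u0 i; rewrite mxE => /ltW.
  by have := v0 i; rewrite mxE.
move=> /allP h; apply/matrixP => i j; rewrite (ord1 j) mxE; apply/eqP.
have := h i (mem_index_enum _); rewrite mxE mulf_eq0 => /orP[|//].
by have := u0 i; rewrite mxE => /lt0r_neq0/negbTE ->.
Qed.

(** * Theorems of the alternative *)

(* Bartl's induction on the number of rows: if [b] is negative at some [x0] that
   satisfies all inequalities but the first, project along [x0] onto the kernel
   of the first row [a]. *)
Lemma farkas (R : realType) (N n : nat) (M : 'M[R]_(n, N)) (b : 'cV[R]_N) :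
  (forall v, vle 0 (M *m v) -> 0 <= (b^T *m v) 0 0) ->
  exists l, vle 0 l /\ b = M^T *m l.
Proof.
elim: n M b => [|n IHn] M b hb.
  exists 0; split=> [i|]; first by rewrite lexx.
  rewrite mulmx0; apply: vle0_anti => i; rewrite mxE.
    have /hb : vle 0 (M *m delta_mx i 0) by case.
    by rewrite -colE !mxE.
  have /hb : vle 0 (M *m - delta_mx i 0) by case.
  by rewrite mulmxN -colE !mxE oppr_ge0.
have [a [M' ME]] : exists a M', M = col_mx a M' :> 'M[R]_(1 + n, N).
  exists (usubmx (M : 'M[R]_(1 + n, N))), (dsubmx (M : 'M[R]_(1 + n, N))).
  by rewrite vsubmxK.
subst M; rewrite -[n.+1]/(1 + n)%N in hb *.
(* If the first inequality is redundant, the remaining rows suffice and [a] receives multiplier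
   0. *)
have [h|] := pselect (forall v, vle 0 (M' *m v) -> 0 <= (b^T *m v) 0 0).
  have [l [l0 ->]] := IHn _ _ h.
  exists (col_mx (0 : 'cV[R]_1) l); split.
    by apply/vle_col_mx; split=> // i; rewrite lexx.
  by rewrite tr_col_mx mul_row_col mulmx0 add0r.
move=> /existsNP[x0 /not_implyP[M'x0 /negP]]; rewrite -ltNge => bx0.
have ax0 : (a *m x0) 0 0 < 0.
  rewrite ltNge; apply/negP => ax0; move: bx0; rewrite ltNge => /negP; apply.
  apply: hb; rewrite mul_col_mx; apply/vle_col_mx; split=> // i.
  by rewrite (ord1 i) mxE.
set s : R := (a *m x0) 0 0 in ax0.
have ax0E : a *m x0 = s%:M by rewrite [LHS]mx11_scalar.
have [l [l0 bE]] : exists l, vle 0 l /\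
    b - s^-1 *: (a^T *m (x0^T *m b)) = (M' - s^-1 *: (M' *m x0 *m a))^T *m l.
  apply: IHn => v M''v; pose y := v - s^-1 *: (x0 *m (a *m v)).
  have ay : a *m y = 0.
    rewrite mulmxBr -scalemxAr (mulmxA a) ax0E mul_scalar_mx scalerA.
    by rewrite mulVf ?scale1r ?subrr// lt_eqF.
  have M'y : M' *m y = (M' - s^-1 *: (M' *m x0 *m a)) *m v.
    by rewrite mulmxBr mulmxBl -scalemxAr -scalemxAl !mulmxA.
  have -> : (b - s^-1 *: (a^T *m (x0^T *m b)))^T *m v = b^T *m y.
    rewrite mulmxBr linearB/= mulmxBl linearZ/= !trmx_mul !trmxK.
    by rewrite -scalemxAr -scalemxAl !mulmxA.
  apply: hb; rewrite mul_col_mx; apply/vle_col_mx; split.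
    by move=> i; rewrite ay.
  by rewrite M'y.
(* Collecting the multiples of [a] in [bE] gives its multiplier. It is nonnegative because [s < 0],
   [b] is negative at [x0], and [M' x0] and [l] are nonnegative. *)
exists (col_mx (s^-1 *: (x0^T *m b - (M' *m x0)^T *m l)) l); split.
  apply/vle_col_mx; split=> // i; rewrite (ord1 i) [_ 0 0]mxE.
  rewrite [leRHS]mxE [X in _ * X]mxE [X in _ + X]mxE.
  rewrite nmulr_rge0 ?invr_lt0// subr_le0 (le_trans _ (dot_ge0 M'x0 l0))//.
  by rewrite -[b]trmxK -trmx_mul mxE ltW.
rewrite tr_col_mx mul_row_col -[LHS](subrK (s^-1 *: (a^T *m (x0^T *m b)))) bE.
rewrite linearB linearZ/= mulmxBl -!scalemxAl -!scalemxAr !trmx_mul mulmxBr.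
by rewrite scalerBr !mulmxA addrC addrA addrAC.
Qed.

(* Farkas applied to minus the [i]-th row gives a nonnegative relation between
   the rows in which row [i] has positive coefficient; sum these over [i]. *)
Lemma stiemke (R : realType) (N n : nat) (M : 'M[R]_(n, N)) :
  (forall v, vle 0 (M *m v) -> M *m v = 0) ->
  exists u, vlt 0 u /\ M^T *m u = 0.
Proof.
move=> hM.
have /choice[l hl] : forall i, exists l : 'cV[R]_n,
    vle 0 l /\ - (row i M)^T = M^T *m l.
  move=> i; apply: farkas => v /hM Mv0.
  by rewrite linearN/= trmxK mulNmx -row_mul Mv0 !mxE oppr0.
exists (\sum_i (delta_mx i 0 + l i)); split; last first.
  rewrite mulmx_sumr big1// => i _; rewrite mulmxDr -colE -(hl i).2.
  by rewrite tr_row subrr.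
move=> k; rewrite mxE summxE (bigD1 k)//=.
have l0 i j : 0 <= l i j 0 by have := (hl i).1 j; rewrite mxE.
rewrite !mxE !eqxx/= ltr_wpDr//; last by rewrite ltr_pwDl.
by apply: sumr_ge0 => i _; rewrite mxE addr_ge0// mxE ler0n.
Qed.

Lemma positive_weights_normalize (R : realType) (k : nat) (z : 'cV[R]_k) :
  (0 < k)%N -> vlt 0 z ->
  exists2 c : R, 0 < c & positive_weights (c *: z).
Proof.
move=> k0 z0; have {}z0 i : 0 < z i 0 by have := z0 i; rewrite mxE.
pose s := \sum_i z i 0.
have s0 : 0 < s.
  rewrite /s (bigD1 (Ordinal k0))//= ltr_wpDr//.
  by apply: sumr_ge0 => i _; exact: ltW.
exists s^-1; first by rewrite invr_gt0.
split=> [i|k1 i|].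
- by rewrite !mxE mulr_gt0// invr_gt0.
- rewrite !mxE mulrC ltr_pdivrMr// mul1r /s (bigD1 i)//= ltrDl.
  (* A second coordinate, also positive, makes the sum strictly larger than [z i 0]. *)
  have [j ji] : exists j : 'I_k, j != i.
    case: (eqVneq (Ordinal k0) i) => [<-|]; last by exists (Ordinal k0).
    by exists (Ordinal k1).
  rewrite (bigD1 j)//= ltr_wpDr//.
  by apply: sumr_ge0 => i' _; exact: ltW.
- by under eq_bigr do rewrite mxE; rewrite -mulr_sumr mulVf// gt_eqF.
Qed.

(** Stiemke's alternative for the rows of [C], [-W], [A] and [-A], the last two blocks encoding the
    equation [A v = 0]. Conversely, pairing the multiplier relation with [v] equates a nonnegative
    number with a nonpositive one; both vanish, and strict positivity of the multipliers forces
    [C v = 0] and [W v = 0]. *)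
Lemma pointed_coneP (R : realType) (N m p k : nat) (A : 'M[R]_(m, N))
    (C : 'M[R]_(p, N)) (W : 'M[R]_(k, N)) : (0 < k)%N ->
  (forall v, A *m v = 0 -> vle 0 (C *m v) -> vle (W *m v) 0 -> v = 0) <->
  [set v : 'cV[R]_N | [/\ A *m v = 0, C *m v = 0 & W *m v = 0]] = [set 0] /\
  exists z z' z'', [/\ vlt 0 z', positive_weights z'' &
                       A^T *m z - C^T *m z' + W^T *m z'' = 0].
Proof.
move=> k0; split=> [h|[ker [z [z' [z'' [z'0 [z''0 _ _] zE]]]]] v Av Cv Wv].
  split.
    apply/seteqP; split=> v /= => [[Av Cv Wv]|->]; last by rewrite !mulmx0.
    by apply: h => //; [rewrite Cv|rewrite Wv] => i; rewrite lexx.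
  have [v|u [u0 uE]] :=
      @stiemke _ _ _ (col_mx (col_mx C (- W)) (col_mx A (- A))).
    rewrite !mul_col_mx => /vle_col_mx[/vle_col_mx[Cv Wv] /vle_col_mx[Av Av']].
    rewrite (h v) ?mulmx0 ?col_mx0//.
      by apply: vle0_anti => //; apply/vle0N; rewrite -mulNmx.
    by apply/vle0N; rewrite -mulNmx.
  have {u0} u0 i : 0 < u i 0 by have := u0 i; rewrite mxE.
  move: uE; rewrite -[u]vsubmxK -[usubmx u]vsubmxK -[dsubmx u]vsubmxK.
  rewrite !tr_col_mx !mul_row_col !linearN/= !mulNmx.
  set a := usubmx (usubmx u); set b := dsubmx (usubmx u).
  set c := usubmx (dsubmx u); set d := dsubmx (dsubmx u) => uE.
  have a0 : vlt 0 a by move=> i; rewrite !mxE.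
  have b0 : vlt 0 b by move=> i; rewrite !mxE.
  have [s s0 bs] := positive_weights_normalize k0 b0.
  (* [s] normalizes the multiplier of [W]. The multipliers [c] and [d] of [A] and [-A] merge into
     one vector of free sign, and the relation is multiplied by [- s] to match the signs of the
     statement. *)
  exists (- s *: (c - d)), (s *: a), (s *: b); split => //.
    by move=> i; rewrite mxE [ltRHS]mxE mulr_gt0//; have := a0 i; rewrite mxE.
  rewrite -[RHS](scaler0 _ (- s)) -uE -!scalemxAr mulmxBr.
  move: (A^T *m c) (A^T *m d) (C^T *m a) (W^T *m b) => x1 x2 x3 x4.
  by apply/matrixP => i j; rewrite !mxE; ring.
have /(congr1 (fun M => (M^T *m v) 0 0)) := zE.
rewrite !linearD/= !linearN/= !mulmxDl !trmx_mul !trmxK mulNmx -!mulmxA Av.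
rewrite mulmx0 add0r trmx0 mul0mx.
have {}Wv : vle 0 (- (W *m v)) by apply/vle0N.
have := dot_ge0 (vltW z'0) Cv; have := dot_ge0 (vltW z''0) Wv.
have := dot_pos_eq0 z'0 Cv; have := dot_pos_eq0 z''0 Wv.
rewrite mulmxN [X in X = 0]mxE [leRHS]mxE.
set b := (z'^T *m (C *m v)) 0 0; set a := (z''^T *m (W *m v)) 0 0.
move=> W0 C0 a0 b0; rewrite mxE [X in X + _]mxE [RHS]mxE -/a -/b => ab.
have : v \in [set 0]; last by rewrite inE.
rewrite -ker inE; split => //; first by apply: C0; lra.
by rewrite -[LHS]opprK W0 ?oppr0//; lra.
Qed.

(** * Directional derivatives and strict convexity *)

Lemma gradientE (R : realType) (m : nat) (f : 'cV[R]_m -> R) (u w : 'cV[R]_m) :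
  differentiable f u -> ((gradient f u)^T *m w) 0 0 = 'D_w f u.
Proof.
move=> df; rewrite [in RHS](matrix_sum_delta w) deriveE// linear_sum/= mxE.
apply: eq_bigr => i _; rewrite big_ord1 linearZ/= -deriveE// !mxE.
by rewrite mulrC.
Qed.

Lemma derive_cvg_at_right (R : realType) (m : nat) (f : 'cV[R]_m -> R)
    (u w : 'cV[R]_m) : derivable f u w ->
  t^-1 * (f (u + t *: w) - f u) @[t --> 0^'+] --> 'D_w f u.
Proof.
move=> df; apply: cvg_dnbhs_at_right.
by under eq_fun do rewrite (addrC u); exact: df.
Qed.

Lemma near_derive_lt0 (R : realType) (m : nat) (f : 'cV[R]_m -> R)
    (u w : 'cV[R]_m) : derivable f u w -> 'D_w f u < 0 ->
  \forall t \near 0^'+, f (u + t *: w) < f u.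
Proof.
move=> /derive_cvg_at_right df dlt0.
near=> t; have t0 : 0 < t by near: t; exact: nbhs_right_gt.
rewrite -subr_lt0 -(pmulr_rlt0 (x := t^-1)) ?invr_gt0//.
by near: t; exact: (cvgr_lt _ df).
Unshelve. all: by end_near. Qed.

(** Limits preserve only weak inequalities, so the strict decrease is obtained first, at the
    midpoint. Convexity between [u] and the midpoint then bounds the difference quotients by this
    fixed negative number. *)
Lemma strictly_convex_derive_lt0 (R : realType) (m : nat) (f : 'cV[R]_m -> R)
    (u w : 'cV[R]_m) : strictly_convex f -> differentiable f u ->
  w != 0 -> f (u + w) <= f u -> 'D_w f u < 0.
Proof.
move=> fconv df w0 fuw; pose w2 := 2^-1 *: w.
have fw2 : f (u + w2) < f u.
  have := fconv (u + w) u 2^-1; rewrite -subr_eq0 addrC addKr w0.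
  have -> : 2^-1 *: (u + w) + (1 - 2^-1) *: u = u + w2.
    by rewrite scalerDr addrAC -scalerDl addrCA subrr addr0 scale1r.
  by move=> /(_ isT); lra.
suff : 'D_w2 f u <= f (u + w2) - f u.
  rewrite !deriveE// linearZ/= => h.
  have : 2^-1 *: 'd f u w < 0 by rewrite (le_lt_trans h)// subr_lt0.
  by rewrite /GRing.scale/= pmulr_rlt0// invr_gt0.
have /derive_cvg_at_right df2 : derivable f u w2 by exact: diff_derivable.
apply: (cvgr_to_le df2).
near=> t; have t0 : 0 < t by near: t; exact: nbhs_right_gt.
have t1 : t < 1 by near: t; exact: nbhs_right_lt.
rewrite ler_pdivrMl//.
have := fconv (u + w2) u t; rewrite -subr_eq0 addrC addKr.
rewrite scaler_eq0 invr_eq0 pnatr_eq0/= w0.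
have -> : t *: (u + w2) + (1 - t) *: u = u + t *: w2.
  by rewrite scalerDr addrAC -scalerDl addrCA subrr addr0 scale1r.
by move=> /(_ isT t0 t1); lra.
Unshelve. all: by end_near. Qed.

Lemma near_continuous_lt (R : realType) (m : nat) (f : 'cV[R]_m -> R)
    (u w : 'cV[R]_m) (e : R) : {for u, continuous f} -> f u < e ->
  \forall t \near 0^'+, f (u + t *: w) < e.
Proof.
move=> cf fue; apply: (cvgr_lt (f u)) => //.
apply: cvg_at_right_filter.
have path_cvg : u + t *: w @[t --> (0 : R)] --> u.
  rewrite -[X in _ --> X]addr0 -[X in _ + X](scale0r w).
  by apply: cvgD; [exact: cvg_cst|apply: cvgZr_tmp; exact: cvg_id].
exact: (cvg_comp _ _ path_cvg cf).
Qed.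

(** * Small steps and active index sets *)

Lemma rows_mul (R : realType) (N k : nat) (M : 'M[R]_(k, N)) (J : {set 'I_k})
    (v : 'cV[R]_N) (i : 'I_#|J|) :
  (rows M J *m v) i 0 = (M *m v) (enum_val i) 0.
Proof. by rewrite !mxE; apply: eq_bigr => j _; rewrite mxE. Qed.

(** Here [a] is the slack of a constraint and [b] its rate of change: a positive slack absorbs any
    slope for small [t], and only a zero slack restricts the direction. *)
Lemma near_affine_ge0 (R : realType) (a b : R) :
  0 <= a -> (a = 0 -> 0 <= b) -> \forall t \near 0^'+, 0 <= a + t * b.
Proof.
rewrite le_eqVlt => /predU1P[<- /(_ erefl) b0|a0 _].
  near=> t; have t0 : 0 <= t by near: t; exact: nbhs_right_ge.
  by rewrite add0r mulr_ge0.
have [b0|b0] := leP 0 b; near=> t.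
  have t0 : 0 <= t by near: t; exact: nbhs_right_ge.
  by rewrite addr_ge0 ?mulr_ge0// ltW.
rewrite -lerBlDr sub0r -mulrN -ler_pdivlMr ?oppr_gt0//.
by rewrite ltW//; near: t; apply: nbhs_right_lt; rewrite divr_gt0// oppr_gt0.
Unshelve. all: by end_near. Qed.

Lemma near_constraints (R : realType) (N p : nat) (C : 'M[R]_(p, N))
    (d : 'cV[R]_p) (x v : 'cV[R]_N) :
  vle d (C *m x) -> vle 0 (rows C (active_constraints C d x) *m v) ->
  \forall t \near 0^'+, vle d (C *m (x + t *: v)).
Proof.
move=> dCx Cv; apply: filter_forall => i; near=> t.
have -> : (C *m (x + t *: v)) i 0 = (C *m x) i 0 + t * (C *m v) i 0.
  by rewrite mulmxDr -scalemxAr mxE [X in _ + X]mxE.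
rewrite -subr_ge0 addrAC.
near: t; apply: near_affine_ge0; first by rewrite subr_ge0.
move=> ai; have iJ : i \in active_constraints C d x.
  by rewrite inE mxE [X in _ + X]mxE ai.
by have := Cv (enum_rank_in iJ i); rewrite rows_mul enum_rankK_in// mxE.
Unshelve. all: by end_near. Qed.

(** Converse to [near_constraints]: on active rows [C x] equals [d], so the difference to [x'] is
    admissible whatever its length. *)
Lemma constraints_direction (R : realType) (N p : nat) (C : 'M[R]_(p, N))
    (d : 'cV[R]_p) (x x' : 'cV[R]_N) :
  vle d (C *m x') -> vle 0 (rows C (active_constraints C d x) *m (x' - x)).
Proof.
move=> dCx' i; rewrite rows_mul mxE mulmxBr.
have := dCx' (enum_val i); have := enum_valP i; rewrite inE.
move: (C *m x) (C *m x') => a b; rewrite !mxE subr_eq0 => /eqP ->.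
by rewrite subr_ge0.
Qed.

Lemma max_affine_ge (R : realType) (N l : nat) (P : 'M[R]_(l.+1, N))
    (gamma : 'cV[R]_l.+1) (x : 'cV[R]_N) (j : 'I_l.+1) :
  (P *m x + gamma) j 0 <= max_affine P gamma x.
Proof. exact: (le_bigmax _ (fun j => (P *m x + gamma) j 0)). Qed.

Lemma near_max_affine (R : realType) (N l : nat) (P : 'M[R]_(l.+1, N))
    (gamma : 'cV[R]_l.+1) (x v : 'cV[R]_N) :
  vle (rows P (active_pieces P gamma x) *m v) 0 ->
  \forall t \near 0^'+,
    max_affine P gamma (x + t *: v) <= max_affine P gamma x.
Proof.
move=> Wv; have : \forall t \near 0^'+, forall j,
    (P *m (x + t *: v) + gamma) j 0 <= max_affine P gamma x.
  apply: filter_forall => j; near=> t.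
  rewrite -subr_ge0.
  have -> : max_affine P gamma x - (P *m (x + t *: v) + gamma) j 0 =
     (max_affine P gamma x - (P *m x + gamma) j 0) + t * - (P *m v) j 0.
    rewrite mulmxDr -scalemxAr; move: (P *m x) (P *m v) => a b.
    by rewrite !mxE; ring.
  near: t; apply: near_affine_ge0; first by rewrite subr_ge0 max_affine_ge.
  move=> /eqP; rewrite subr_eq0 => ai.
  have iJ : j \in active_pieces P gamma x by rewrite inE eq_sym.
  rewrite oppr_ge0; have := Wv (enum_rank_in iJ j).
  by rewrite rows_mul enum_rankK_in// [leRHS]mxE.
by apply: filterS => t ht; apply: bigmax_le.
Unshelve. all: by end_near. Qed.

(** An active piece equals the maximum at [x] and is bounded by the maximum at [x'], so it cannot
    increase from [x] to [x']. *)
Lemma max_affine_direction (R : realType) (N l : nat) (P : 'M[R]_(l.+1, N))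
    (gamma : 'cV[R]_l.+1) (x x' : 'cV[R]_N) :
  max_affine P gamma x' <= max_affine P gamma x ->
  vle (rows P (active_pieces P gamma x) *m (x' - x)) 0.
Proof.
move=> gx' i; rewrite rows_mul [leRHS]mxE mulmxBr.
have := enum_valP i; rewrite inE => /eqP gx.
have := le_trans (max_affine_ge P gamma x' (enum_val i)) gx'; rewrite -gx.
by move: (P *m x) (P *m x') => a b; rewrite !mxE lerD2r subr_le0.
Qed.

(** A finite maximum is attained. Normalizing the weights on the active pieces relies on this. *)
Lemma active_pieces_gt0 (R : realType) (N l : nat) (P : 'M[R]_(l.+1, N))
    (gamma : 'cV[R]_l.+1) (x : 'cV[R]_N) : (0 < #|active_pieces P gamma x|)%N.
Proof.
rewrite lt0n; apply/negP => /eqP/card0_eq h.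
have := ltxx (max_affine P gamma x); rewrite {1}/max_affine => /negP; apply.
have lt_max j : (P *m x + gamma) j 0 < max_affine P gamma x.
  rewrite lt_neqAle max_affine_ge andbT.
  by have := h j; rewrite inE => ->.
by apply/bigmax_ltP; split.
Qed.

(** * Uniqueness and descent directions *)

Lemma unique_minimizerP (R : realType) (T : Type) (g : T -> R) (S : set T)
    (x : T) : S x ->
  unique_minimizer g S x <-> forall x', S x' -> g x' <= g x -> x' = x.
Proof.
move=> Sx; split=> [[[_ gmin] uniq] x' Sx' gx'|h].
  by apply: uniq; split=> // x'' /gmin; exact: le_trans.
split=> [|x' [Sx' /(_ _ Sx)]]; last exact: h.
split=> // x' Sx'; rewrite leNgt; apply/negP => gx'.
by move: (gx'); rewrite (h _ Sx' (ltW gx')) ltxx.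
Qed.

(** Farkas' lemma for the stacked rows of [C] and [-W]; with [b] the gradient of [f] composed with
    [A], this turns the absence of descent directions into multipliers. *)
Lemma no_descent_directionP (R : realType) (N p k : nat) (b : 'cV[R]_N)
    (C : 'M[R]_(p, N)) (W : 'M[R]_(k, N)) :
  (forall v, vle 0 (C *m v) -> vle (W *m v) 0 -> 0 <= (b^T *m v) 0 0) <->
  exists w w', [/\ vle 0 w, vle 0 w' & b - C^T *m w + W^T *m w' = 0].
Proof.
split=> [h|[w [w' [w0 w'0 bE]]] v Cv Wv].
  have [v|l [l0 bE]] := @farkas _ _ _ (col_mx C (- W)) b.
    rewrite mul_col_mx => /vle_col_mx[Cv Wv]; apply: h => //.
    by apply/vle0N; rewrite -mulNmx.
  move: l0; rewrite -[l]vsubmxK => /vle_col_mx[l1 l2].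
  exists (usubmx l), (dsubmx l); split => //.
  rewrite bE -[in l in _ *m l](vsubmxK l) tr_col_mx mul_row_col.
  by rewrite linearN/= mulNmx addrAC subrK subrr.
have -> : b = C^T *m w - W^T *m w'.
  by apply/eqP; rewrite -subr_eq0 opprB addrA addrAC bE.
rewrite linearB/= mulmxBl !trmx_mul !trmxK -!mulmxA -mulmxN mxE.
by rewrite addr_ge0 ?dot_ge0//; apply/vle0N.
Qed.

Theorem theorem3p3 (R : realType) (N m p l : nat)
    (P : 'M[R]_(l.+1, N)) (gamma : 'cV[R]_l.+1)
    (A : 'M[R]_(m, N)) (y : 'cV[R]_m)
    (C : 'M[R]_(p, N)) (d : 'cV[R]_p)
    (f : 'cV[R]_m -> R) (eps : R) (xs : 'cV[R]_N) :
  let g := max_affine P gamma in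
  let D1 := feasible f A y eps C d in
  let Ca := rows C (active_constraints C d xs) in
  let I := active_pieces P gamma xs in
  let W := rows P I in
  let df := gradient f (A *m xs - y) in
  continuously_differentiable f ->
  strictly_convex f ->
  (exists x, minimizer g D1 x) ->
  D1 xs ->
  (forall i, i \in I -> ~ convex_combination P (I :\ i)%SET (row i P)) ->
  (f (A *m xs - y) < eps ->
     (unique_minimizer g D1 xs <->
      [set v : 'cV[R]_N | Ca *m v = 0 /\ W *m v = 0] = [set 0] /\
      (exists z z', [/\ vlt 0 z, positive_weights z' &
                        Ca^T *m z = W^T *m z']))) /\
  (f (A *m xs - y) = eps ->
     (unique_minimizer g D1 xs <->
      [/\ [set v : 'cV[R]_N | [/\ A *m v = 0, Ca *m v = 0 & W *m v = 0]]
            = [set 0],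
          (exists z z' z'', [/\ vlt 0 z', positive_weights z'' &
                                A^T *m z - Ca^T *m z' + W^T *m z'' = 0]) &
          ([set v : 'cV[R]_N | (df^T *m A *m v) 0 0 < 0 /\ vle 0 (Ca *m v)]
             !=set0 ->
           exists w w', [/\ vle 0 w, vle 0 w' &
                            A^T *m df - Ca^T *m w + W^T *m w' = 0])])).
Proof.
move=> g D1 Ca I W df [fdiff _] fconv _ D1xs _.
set u := A *m xs - y in df *; have {}fdiff := fdiff u.
have k0 : (0 < #|I|)%N by exact: active_pieces_gt0.
have uE x : A *m x - y = u + A *m (x - xs).
  by rewrite mulmxBr [RHS]addrC addrA subrK.
have uniqE := unique_minimizerP g D1xs.
have cone x : D1 x -> g x <= g xs ->
    vle 0 (Ca *m (x - xs)) /\ vle (W *m (x - xs)) 0.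
  move=> [_ dCx] gx; split; first exact: constraints_direction.
  exact: max_affine_direction.
have uniq_cone v : unique_minimizer g D1 xs ->
    vle 0 (Ca *m v) -> vle (W *m v) 0 ->
    (\forall t \near 0^'+, f (u + t *: (A *m v)) <= eps) -> v = 0.
  move=> /uniqE uniq Cv Wv fv.
  (* One small positive [t] makes [xs + t *: v] feasible with value at most [g xs], so uniqueness
     makes it equal to [xs]. *)
  near (0 : R)^'+ => t; have t0 : 0 < t by near: t; exact: nbhs_right_gt.
  have /eqP : xs + t *: v = xs.
    apply: uniq; last by near: t; exact: near_max_affine.
    split; last by near: t; apply: near_constraints => //; exact: D1xs.2.
    by rewrite uE [xs + _]addrC addrK -scalemxAr; near: t.
  by rewrite -subr_eq0 addrAC subrr add0r scaler_eq0 gt_eqF//= => /eqP.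
have dfE v : (df^T *m A *m v) 0 0 = 'D_(A *m v) f u.
  by rewrite -mulmxA gradientE.
split=> fu.
  (* A matrix with no rows makes the condition [A v = 0] vacuous, so the inactive case becomes an
     instance of [pointed_coneP]. *)
  have -> : unique_minimizer g D1 xs <->
      forall v, (0 : 'M[R]_(0, N)) *m v = 0 -> vle 0 (Ca *m v) ->
        vle (W *m v) 0 -> v = 0.
    split=> [uniq v _ Cv Wv|h].
      apply: uniq_cone => //.
      have : \forall t \near 0^'+, f (u + t *: (A *m v)) < eps.
        by apply: near_continuous_lt => //; exact: differentiable_continuous.
      by apply: filterS => t /ltW.
    apply/uniqE => x Dx gx; have [Cx Wx] := cone _ Dx gx.
    by apply/eqP; rewrite -subr_eq0; apply/eqP/h => //; rewrite mul0mx.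
  rewrite pointed_coneP//; split=> [[ker [z [z' [z'' [z0 z'0 zE]]]]]|].
    split; last first.
      exists z', z''; split=> //.
      apply/eqP; rewrite -subr_eq0 -oppr_eq0 opprB addrC -zE.
      by rewrite trmx0 mul0mx add0r.
    by rewrite -ker; apply/seteqP; split=> v /= => [|[]] // []; rewrite mul0mx.
  move=> [ker [z [z' [z0 z'0 zE]]]]; split.
    by rewrite -ker; apply/seteqP; split=> v /= => [[]|[]] //; rewrite mul0mx.
  by exists 0, z, z'; split=> //; rewrite zE trmx0 mul0mx add0r addNr.
(* The first half will yield (2.i) and (2.ii), the second (2.iii). *)
have -> : unique_minimizer g D1 xs <->
    (forall v, A *m v = 0 -> vle 0 (Ca *m v) -> vle (W *m v) 0 -> v = 0) /\
    (forall v, vle 0 (Ca *m v) -> vle (W *m v) 0 ->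
      0 <= ((A^T *m df)^T *m v) 0 0).
  split=> [uniq|[h1 h2]].
    split=> v.
      move=> Av Cv Wv; apply: uniq_cone => //.
      (* Along the kernel of [A] the value of [f] stays equal to [eps]. *)
      by rewrite Av; near=> t; rewrite scaler0 addr0 fu.
    move=> Cv Wv; rewrite trmx_mul trmxK dfE leNgt; apply/negP => dlt0.
    have v0 : v = 0.
      apply: uniq_cone => //; rewrite -fu.
      have := near_derive_lt0 (diff_derivable fdiff) dlt0.
      by apply: filterS => t /ltW.
    by move: dlt0; rewrite v0 mulmx0 deriveE// linear0 ltxx.
  apply/uniqE => x Dx gx; have [Cx Wx] := cone _ Dx gx.
  (* If [A (x - xs)] were nonzero, strict convexity would make [x - xs] a strict descent direction,
     contradicting [h2]; hence [h1] applies. *)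
  apply/eqP; rewrite -subr_eq0; apply/eqP/h1 => //; apply/eqP.
  apply: contraT => Ax0; have := h2 _ Cx Wx.
  rewrite trmx_mul trmxK dfE leNgt strictly_convex_derive_lt0//.
  by rewrite -uE fu; exact: Dx.1.
rewrite pointed_coneP//; split=> [[[ker zE] h]|[ker zE h]].
  by split=> // _; apply/no_descent_directionP.
(* A [v] violating the claim lies in the set of (2.iii); the multipliers this provides exclude such
   a descent direction. *)
split=> // v Cv Wv; rewrite leNgt; apply/negP => dlt0.
have : 0 <= ((A^T *m df)^T *m v) 0 0; last by rewrite leNgt dlt0.
have /no_descent_directionP nodesc : exists w w',
    [/\ vle 0 w, vle 0 w' & A^T *m df - Ca^T *m w + W^T *m w' = 0].
  by apply: h; exists v; split=> //; move: dlt0; rewrite trmx_mul trmxK.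
exact: nodesc.
Unshelve. all: by end_near. Qed.
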